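(* Let $n \ge 1$ be a natural number and let $\mathcal{B}_n$ be the set of all bistochastic matrices of order $n$. For every $B \in \mathcal{B}_n$, the matching factor $M(B)$ satisfies $$\frac{1}{n^{2n}} \le M(B) \le 1.$$ Moreover, both bounds are achieved, with $$\max_{B \in \mathcal{B}_n} M(B) = 1, \qquad \operatorname*{arg\,max}_{B \in \mathcal{B}_n} M(B) = \mathcal{P}_n,$$ and $$\min_{B \in \mathcal{B}_n} M(B) = \frac{1}{n^{2n}}, \qquad \operatorname*{arg\,min}_{B \in \mathcal{B}_n} M(B) = \{U_n\},$$ where $\mathcal{P}_n$ is the set of all permutation matrices of order $n$ and $U_n$ is the uniform matrix of order $n$. Here $\operatorname{arg\,max}$ and $\operatorname{arg\,min}$ denote the sets of all maximizers and all minimizers of $M$ over $\mathcal{B}_n$, respectively.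
   Context: A matrix of order $n$ is an $n \times n$ real matrix. It is non-negative if all its entries are non-negative. A non-negative matrix $B$ of order $n$ is bistochastic if $\sum_{i=1}^n B_{ki} = \sum_{j=1}^n B_{jk} = 1$ for all $k \in \{1,\dots,n\}$; $\mathcal{B}_n$ denotes the set of all such matrices. A permutation matrix of order $n$ is a bistochastic matrix of order $n$ in which each row and each column has exactly one non-zero entry, and that entry equals $1$; $\mathcal{P}_n$ denotes the set of these. The uniform matrix $U_n$ of order $n$ is the matrix all of whose entries equal $1/n$. For a matrix $B$ of order $n$, $B_{k.}$ denotes its $k$-th row, $B_{.k}$ its $k$-th column, and $\|\cdot\|_2$ the Euclidean norm. For a bistochastic matrix $B$ of order $n$, the $k$-th matching factor is $\lambda(k) = \|B_{k.}\|_2^2 \, \|B_{.k}\|_2^2$ for $k = 1,\dots,n$, and the matching factor of $B$ is $M(B) = \prod_{k=1}^n \lambda(k)$. *)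

(* Defs.v *)
From mathcomp Require Import all_boot all_order all_fingroup all_algebra.
From mathcomp Require Import classical_sets reals.

Set Implicit Arguments.
Unset Strict Implicit.
Unset Printing Implicit Defensive.

Import Order.TTheory GRing.Theory Num.Theory.

Local Open Scope classical_set_scope.
Local Open Scope ring_scope.

Section Optimization.
Context {R : realType}.

Definition is_max (E : set R) (m : R) : Prop := E m /\ ubound E m.

Definition is_min (E : set R) (m : R) : Prop := E m /\ lbound E m.

Definition argmax {T : Type} (A : set T) (f : T -> R) : set T :=
  [set x | A x /\ forall y, A y -> f y <= f x].

Definition argmin {T : Type} (A : set T) (f : T -> R) : set T :=
  [set x | A x /\ forall y, A y -> f x <= f y].

End Optimization.

Section Matrices.
Context {R : realType}.

(* The Euclidean norm; MathComp's canonical norm on matrices is the sup norm. *)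
Definition norm2 {n : nat} (v : 'rV[R]_n) : R :=
  Num.sqrt (\sum_(i < n) v 0 i ^+ 2).

Definition nonneg_mx {n : nat} (B : 'M[R]_n) : Prop := forall i j, 0 <= B i j.

Definition bistochastic (n : nat) : set 'M[R]_n :=
  [set B | nonneg_mx B /\
    forall k, \sum_(i < n) B k i = 1 /\ \sum_(j < n) B j k = 1].

Definition permutation_mx (n : nat) : set 'M[R]_n :=
  [set B | [/\ bistochastic B,
    forall i, exists! j, B i j != 0,
    forall j, exists! i, B i j != 0 &
    forall i j, B i j != 0 -> B i j = 1]].

Definition uniform_mx (n : nat) : 'M[R]_n := const_mx (1 / n%:R).

Definition matching_factor_at {n : nat} (B : 'M[R]_n) (k : 'I_n) : R :=
  norm2 (row k B) ^+ 2 * norm2 (col k B)^T ^+ 2.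

Definition matching_factor {n : nat} (B : 'M[R]_n) : R :=
  \prod_(k < n) matching_factor_at B k.

Lemma permutation_mxP (n : nat) (B : 'M[R]_n) :
  permutation_mx B <-> is_perm_mx B.
Proof.
split=> [[_ Hr Hc H1]|/is_perm_mxP [s ->]].
  pose f i := odflt i [pick j | B i j != 0].
  have fP i : B i (f i) != 0.
    rewrite /f; case: pickP => [j //|H0].
    by have [j [Hj _]] := Hr i; move: (H0 j); rewrite Hj.
  have f_inj : injective f.
    move=> i k eqf; have [l [_ Hl]] := Hc (f i).
    by rewrite -(Hl i (fP i)) -(Hl k) // eqf; apply: fP.
  apply/is_perm_mxP; exists (perm f_inj); apply/matrixP=> i j.
  rewrite !mxE permE; case: eqP => [<-|ne]; first exact: H1 (fP i).
  apply/eqP; apply: contraT => Bij; case: ne.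
  by have [l [_ Hl]] := Hr i; rewrite -(Hl _ (fP i)) (Hl _ Bij).
have E i j : perm_mx s i j = (s i == j)%:R :> R by rewrite !mxE.
have nz i j : (perm_mx s i j != 0 :> R) = (s i == j).
  by rewrite E pnatr_eq0; case: (s i == j).
split.
- split=> [i j|k]; first by rewrite E ler0n.
  split.
    rewrite (bigD1 (s k)) //= E eqxx big1 ?addr0 // => i ne.
    by rewrite E eq_sym (negbTE ne).
  rewrite (bigD1 ((s^-1)%g k)) //= E permKV eqxx big1 ?addr0 // => i ne.
  by rewrite E (can2_eq (permK s) (permKV s)) (negbTE ne).
- by move=> i; exists (s i); split=> [|j]; rewrite nz // => /eqP.
- move=> j; exists ((s^-1)%g j); split=> [|i]; rewrite nz ?permKV //.
  by move=> /eqP <-; rewrite permK.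
- by move=> i j; rewrite nz E => ->.
Qed.

End Matrices.

Arguments bistochastic R n : clear implicits.
Arguments permutation_mx R n : clear implicits.
Arguments uniform_mx R n : clear implicits.

(* Main.v *)
(* For a probability vector f on n points, f i (1 - f i) >= 0 gives
   sum f^2 <= 1, with equality only for a point mass, and expanding
   sum (f i - 1/n)^2 >= 0 gives sum f^2 >= 1/n, with equality only for the
   constant vector.  M(B) is a product of 2n such sums, one per row and one per
   column; all of them are positive, so M(B) attains a bound only if every
   factor does. *)

Require Import Defs.
From mathcomp Require Import all_boot all_order all_fingroup all_algebra.
From mathcomp Require Import classical_sets reals.

Set Implicit Arguments.
Unset Strict Implicit.
Unset Printing Implicit Defensive.

Import Order.TTheory GRing.Theory Num.Theory.

Local Open Scope classical_set_scope.
Local Open Scope ring_scope.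

Section StochasticVector.
Context {R : realFieldType} {I : finType}.
Variable f : I -> R.
Hypotheses (f_ge0 : forall i, 0 <= f i) (f_sum1 : \sum_i f i = 1).

Lemma stochastic_le1 i : f i <= 1.
Proof. by rewrite -f_sum1 (bigD1 i) //= lerDl sumr_ge0. Qed.

Lemma sum_sqr_le1 : \sum_i f i ^+ 2 <= 1.
Proof.
rewrite -[leRHS]f_sum1; apply: ler_sum => i _.
by rewrite expr2 ler_piMl ?stochastic_le1.
Qed.

(** The non-negative terms [f j - f j ^+ 2] sum to 0, so each vanishes and every entry is 0 or 1. *)
Lemma sum_sqr_eq1 : \sum_i f i ^+ 2 = 1 ->
  (exists! i, f i != 0) /\ forall i, f i != 0 -> f i = 1.
Proof.
move=> sq1; have f01 i : f i != 0 -> f i = 1.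
  have h j : true -> 0 <= f j - f j ^+ 2.
    by rewrite subr_ge0 expr2 ler_piMl ?stochastic_le1.
  have /(psumr_eq0P h)/(_ i isT)/eqP : \sum_j (f j - f j ^+ 2) = 0.
    by rewrite sumrB f_sum1 sq1 subrr.
  rewrite expr2 -[X in X - _]mulr1 -mulrBr mulf_eq0 subr_eq0.
  by move=> /orP[->//|/eqP].
(* If every entry were zero, the total would be 0 instead of 1. *)
split=> //; have [i fi|f0] := pickP (fun i => f i != 0); last first.
  have /eqP := oner_neq0 R; case.
  by rewrite -f_sum1 big1 // => i _; apply/eqP/negbFE/f0.
(* Two distinct non-zero entries would both be 1 and push the total to at least 2. *)
exists i; split=> // j fj; apply/eqP; apply: contraT => ij.
have : 1 + 1 <= (1 : R).
  rewrite -[leRHS]f_sum1 (bigD1 i) //= (f01 i fi) lerD2l (bigD1 j) 1?eq_sym //=.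
  by rewrite (f01 j fj) lerDl sumr_ge0.
by rewrite gerDl ler10.
Qed.

(** An empty sum is 0, not 1. This makes [#|I|%:R^-1] a true inverse, so that it can be cancelled
    below. *)
Lemma card_stochastic_gt0 : (0 < #|I|)%N.
Proof.
rewrite lt0n; apply/eqP => /card0_eq I0; have /eqP := oner_neq0 R; case.
by rewrite -f_sum1 big1 // => i; have := I0 i.
Qed.

Lemma sum_sqr_center :
  \sum_i (f i - #|I|%:R^-1) ^+ 2 = \sum_i f i ^+ 2 - #|I|%:R^-1.
Proof.
under eq_bigr do rewrite sqrrB.
(* The cross terms add up to [-2/#|I|] because [f] sums to 1; the constant terms add up to
   [1/#|I|]. *)
rewrite big_split sumrB /= sumrMnl -mulr_suml f_sum1 sumr_const mul1r.
rewrite -[X in _ + X]mulr_natr expr2 mulfVK; last first.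
  by rewrite pnatr_eq0 -lt0n card_stochastic_gt0.
by rewrite mulr2n opprD addrA subrK.
Qed.

Lemma sum_sqr_ge : #|I|%:R^-1 <= \sum_i f i ^+ 2.
Proof.
by rewrite -subr_ge0 -sum_sqr_center sumr_ge0 // => i _; rewrite sqr_ge0.
Qed.

Lemma sum_sqr_eq : \sum_i f i ^+ 2 = #|I|%:R^-1 ->
  forall i, f i = #|I|%:R^-1.
Proof.
move=> sq i; have h j : true -> 0 <= (f j - #|I|%:R^-1) ^+ 2 by rewrite sqr_ge0.
have : \sum_j (f j - #|I|%:R^-1) ^+ 2 = 0 by rewrite sum_sqr_center sq subrr.
by move=> /(psumr_eq0P h)/(_ i isT)/eqP; rewrite sqrf_eq0 subr_eq0 => /eqP.
Qed.

End StochasticVector.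

(** In the chain [a * c <= b * c <= b * d] the ends agree, so both steps are equalities; positivity
    allows cancelling [c] and then [b]. *)
Lemma eq_mul_le (R : realFieldType) (a b c d : R) :
  0 < a -> 0 < c -> a <= b -> c <= d -> a * c = b * d -> a = b /\ c = d.
Proof.
move=> a0 c0 ab cd e; have b0 := lt_le_trans a0 ab.
have eac : a * c = b * c.
  apply/le_anti; rewrite ler_wpM2r ?(ltW c0) //= e.
  by rewrite ler_wpM2l ?(ltW b0).
split; first exact: (mulIf (lt0r_neq0 c0)).
by apply: (mulfI (lt0r_neq0 b0)); rewrite -eac.
Qed.

(** Isolate the factor at [i] and apply [eq_mul_le] to it and the product of the others. *)
Lemma eq_prod_le (R : realFieldType) (I : finType) (F G : I -> R) :
  (forall i, 0 < F i <= G i) -> \prod_i F i = \prod_i G i ->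
  forall i, F i = G i.
Proof.
move=> FG e i; have F0 j : 0 < F j by case/andP: (FG j).
rewrite (bigD1 i) //= [RHS](bigD1 i) //= in e.
have [] // := eq_mul_le _ _ _ _ e.
- exact: prodr_gt0.
- by case/andP: (FG i).
- by apply: ler_prod => j _; case/andP: (FG j) => /ltW ->.
Qed.

Section MatchingFactor.
Context {R : realType} {n : nat}.
Implicit Type B : 'M[R]_n.

Lemma norm2_sqr (v : 'rV[R]_n) : norm2 v ^+ 2 = \sum_i v 0 i ^+ 2.
Proof. by rewrite sqr_sqrtr // sumr_ge0 // => i _; rewrite sqr_ge0. Qed.

Lemma matching_factor_atE B k : matching_factor_at B k =
  (\sum_i B k i ^+ 2) * (\sum_i B i k ^+ 2).
Proof.
rewrite /matching_factor_at !norm2_sqr.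
by congr (_ * _); apply: eq_bigr => i _; rewrite !mxE.
Qed.

Section Bistochastic.
Variable B : 'M[R]_n.
Hypothesis bB : bistochastic R n B.

Let B_ge0 i j : 0 <= B i j. Proof. by case: bB. Qed.
Let row1 k : \sum_i B k i = 1. Proof. by case: bB => _ /(_ k)[]. Qed.
Let col1 k : \sum_j B j k = 1. Proof. by case: bB => _ /(_ k)[]. Qed.

Let row_ge k : n%:R^-1 <= \sum_i B k i ^+ 2.
Proof. by have := sum_sqr_ge (row1 k); rewrite card_ord. Qed.

Let col_ge k : n%:R^-1 <= \sum_i B i k ^+ 2.
Proof. by have := sum_sqr_ge (col1 k); rewrite card_ord. Qed.

Let row_le k : \sum_i B k i ^+ 2 <= 1.
Proof. exact: (sum_sqr_le1 (B_ge0 k)). Qed.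

Let col_le k : \sum_i B i k ^+ 2 <= 1.
Proof. by apply: sum_sqr_le1. Qed.

(** The existence of an index [k] forces [n] to be positive. *)
Let n_inv_gt0 (k : 'I_n) : 0 < n%:R^-1 :> R.
Proof. by rewrite invr_gt0 ltr0n (leq_ltn_trans _ (ltn_ord k)). Qed.

(** The positivity conjunct supplies the strict lower bound that [eq_prod_le] asks for. *)
Lemma matching_factor_at_bounds k :
  [&& 0 < n%:R^-1 * n%:R^-1 :> R, n%:R^-1 * n%:R^-1 <= matching_factor_at B k
    & matching_factor_at B k <= 1].
Proof.
have n0 := n_inv_gt0 k; rewrite matching_factor_atE.
apply/and3P; split; first exact: mulr_gt0.
  by rewrite ler_pM // ltW.
by rewrite mulr_ile1 // sumr_ge0 // => i _; exact: sqr_ge0.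
Qed.

Lemma matching_factor_eq1 : matching_factor B = 1 -> permutation_mx R n B.
Proof.
move=> e; have mk k : matching_factor_at B k = 1.
  apply: (eq_prod_le (G := fun=> 1)) => [i|]; last by rewrite big1_eq.
  by have /and3P[/lt_le_trans h /h -> ->] := matching_factor_at_bounds i.
have sq1 k : \sum_i B k i ^+ 2 = 1 /\ \sum_i B i k ^+ 2 = 1.
  have n0 := n_inv_gt0 k.
  (* Compare (row sum) * (column sum) with [1 * 1]. *)
  apply: eq_mul_le => //; rewrite ?(lt_le_trans n0) //.
  by rewrite -matching_factor_atE mk mulr1.
split=> // [i|j|i j].
- by have [] := sum_sqr_eq1 (B_ge0 i) (row1 i) (sq1 i).1.
- by have [] := sum_sqr_eq1 (B_ge0^~ j) (col1 j) (sq1 j).2.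
- by have [_] := sum_sqr_eq1 (B_ge0 i) (row1 i) (sq1 i).1; apply.
Qed.

Lemma matching_factor_eq_min :
  matching_factor B = (n%:R^-1 * n%:R^-1) ^+ n -> B = uniform_mx R n.
Proof.
move=> e; have mk k : n%:R^-1 * n%:R^-1 = matching_factor_at B k.
  apply: (eq_prod_le (F := fun=> _)) => [i|].
    by have /and3P[-> ->] := matching_factor_at_bounds i.
  by rewrite prodr_const card_ord -e.
apply/matrixP => k j; rewrite mxE div1r.
(* Minimality of row [k] already fixes all its entries. *)
have [rk _] : n%:R^-1 = \sum_i B k i ^+ 2 /\ n%:R^-1 = \sum_i B i k ^+ 2.
  by have n0 := n_inv_gt0 k; apply: eq_mul_le; rewrite // -matching_factor_atE.
by have := sum_sqr_eq (row1 k); rewrite card_ord; apply.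
Qed.

Lemma matching_factor_bounds :
  (n%:R^-1 * n%:R^-1) ^+ n <= matching_factor B <= 1.
Proof.
apply/andP; split.
  rewrite -[X in _ ^+ X]card_ord -prodr_const; apply: ler_prod => k _.
  by have /and3P[/ltW -> ->] := matching_factor_at_bounds k.
apply: prodr_ile1 => k _.
by have /and3P[/lt_le_trans h /h/ltW -> ->] := matching_factor_at_bounds k.
Qed.

End Bistochastic.

(** Entries are 0 or 1, hence equal to their squares, so each sum of squares is a plain row or
    column sum, which is 1. *)
Lemma matching_factor_permutation B :
  permutation_mx R n B -> matching_factor B = 1.
Proof.
move=> [[_ sum1] _ _ B1]; have sqB i j : B i j ^+ 2 = B i j.
  by have [->|/B1 ->] := eqVneq (B i j) 0; rewrite ?expr1n ?expr0n.
apply: big1 => k _; rewrite matching_factor_atE.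
under eq_bigr do rewrite sqB; under [X in _ * X]eq_bigr do rewrite sqB.
by have [-> ->] := sum1 k; rewrite mulr1.
Qed.

Lemma matching_factor_uniform :
  matching_factor (uniform_mx R n) = (n%:R^-1 * n%:R^-1) ^+ n.
Proof.
rewrite -[X in _ ^+ X]card_ord -prodr_const; apply: eq_bigr => k _.
have n0 : n%:R != 0 :> R.
  by rewrite pnatr_eq0 -lt0n (leq_ltn_trans _ (ltn_ord k)).
have sq : \sum_(i < n) (1 / n%:R : R) ^+ 2 = n%:R^-1.
  by rewrite sumr_const card_ord div1r -[LHS]mulr_natr expr2 mulfVK.
rewrite matching_factor_atE; under eq_bigr do rewrite mxE.
by under [X in _ * X]eq_bigr do rewrite mxE; rewrite sq.
Qed.

Lemma bistochastic_uniform : bistochastic R n (uniform_mx R n).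
Proof.
split=> [i j|k]; first by rewrite mxE divr_ge0.
have n0 : n%:R != 0 :> R.
  by rewrite pnatr_eq0 -lt0n (leq_ltn_trans _ (ltn_ord k)).
by split; under eq_bigr do rewrite mxE;
  rewrite sumr_const card_ord div1r -[LHS]mulr_natr mulVf.
Qed.

End MatchingFactor.

Theorem theorem1 (R : realType) (n : nat) (hn : (1 <= n)%N) :
  [/\ forall B : 'M[R]_n, bistochastic R n B ->
        1 / n%:R ^+ (2 * n) <= matching_factor B <= 1,
      is_max (matching_factor @` bistochastic R n) 1,
      argmax (bistochastic R n) matching_factor = permutation_mx R n,
      is_min (matching_factor @` bistochastic R n) (1 / n%:R ^+ (2 * n)) &
      argmin (bistochastic R n) matching_factor = [set uniform_mx R n]].
Proof.
(* Write the bound as a product of [n] equal factors, one per matching factor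
   [matching_factor_at B k]. *)
have -> : 1 / n%:R ^+ (2 * n) = (n%:R^-1 * n%:R^-1) ^+ n :> R.
  by rewrite div1r exprM -exprVn expr2 invfM.
(* The identity matrix serves as the witness that the value 1 is attained. *)
have perm1 : permutation_mx R n 1%:M.
  by apply/permutation_mxP; rewrite -perm_mx1 perm_mx_is_perm.
have bij1 : bistochastic R n 1%:M by case: perm1.
have bU := @bistochastic_uniform R n.
split.
- by move=> B; apply: matching_factor_bounds.
- split; first by exists 1%:M => //; apply: matching_factor_permutation.
  by move=> _ [B /matching_factor_bounds/andP[_ le1] <-].
- apply/seteqP; split=> [B [bB maxB]|B pB].
    (* A maximizer does at least as well as the identity, so its value is exactly 1. *)
    apply: matching_factor_eq1 => //; apply/le_anti.
    have /andP[_ ->] := matching_factor_bounds bB.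
    by rewrite -(matching_factor_permutation perm1) maxB.
  split; first by case: pB.
  move=> C /matching_factor_bounds/andP[_].
  by rewrite (matching_factor_permutation pB).
- split; first by exists (uniform_mx R n) => //; apply: matching_factor_uniform.
  by move=> _ [B /matching_factor_bounds/andP[le _] <-].
- apply/seteqP; split=> [B [bB minB]|_ ->].
    (* A minimizer is compared with the uniform matrix, whose value is the lower bound. *)
    apply: matching_factor_eq_min => //; apply/le_anti.
    have /andP[-> _] := matching_factor_bounds bB.
    by rewrite -matching_factor_uniform minB.
  split=> // C /matching_factor_bounds/andP[+ _].
  by rewrite matching_factor_uniform.
Qed.
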